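(* Let $G$ be an infinite finitely generated group with finite generating set $S_G$, and let $H$ be a finite group. Equip $H\wr G$ with the word metric with respect to the generating set $(H\setminus\{1\})\cup S_G$, and let $K$ be the kernel of the projection $H\wr G\to G$, equipped with the metric induced from $H\wr G$. If the growth function of $G$ is bounded by a linear function, then $\mathrm{dim}_{AN}(K)=0$ and $\mathrm{dim}_{AN}(H\wr G)=\mathrm{dim}_{AN}(G)=1$.
   Context: Wreath product: for groups $A,B$ let $A^{(B)}$ be the group of finitely supported functions $B\to A$, with $B$ acting by $(bf)(\gamma)=f(b^{-1}\gamma)$. Then $A\wr B$ is the set of pairs $(f,b)$ with $f\in A^{(B)}$, $b\in B$ and product $(f_1,b_1)(f_2,b_2)=(f_1\cdot(b_1f_2),b_1b_2)$. One identifies $b\in B$ with $(1,b)$ and $a\in A$ with $(f_a,1)$, where $f_a(1)=a$ and $f_a(\gamma)=1$ for $\gamma\neq 1$; the projection $H\wr G\to G$ is $(f,g)\mapsto g$. The word metric w.r.t. a generating set $S$ is $d(x,y)=$ length of $x^{-1}y$ as a word in $S\cup S^{-1}$. The growth function $\gamma$ of $G$ is $\gamma(r)=\#\{g\in G: |g|_{S_G}<r\}$; being bounded by a linear function does not depend on $S_G$. For a metric space $X$ and $r>0$, an $r$-path is a sequence $x_0,\dots,x_m$ with $d(x_j,x_{j+1})<r$; two points of $Y\subseteq X$ lie in the same $r$-component of $Y$ if they are joined by an $r$-path in $Y$. An $n$-dimensional control function of $X$ is a function $D:\mathbb{R}_+\to\mathbb{R}_+\cup\{\infty\}$ such that for every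 $r>0$ there is a cover $\{X_0,\dots,X_n\}$ of $X$ such that every open ball $B(x,r)$ is contained in some $X_i$ and every $r$-component of every $X_i$ has diameter at most $D(r)$. The Assouad–Nagata dimension $\mathrm{dim}_{AN}(X)$ is the smallest integer $n$ such that $X$ has an $n$-dimensional control function of the form $D(r)=C\cdot r$ for some constant $C>0$ (and $\infty$ if none exists). Groups are given their word metrics. *)

(* Defs.v *)
From Stdlib Require Import Reals List ClassicalEpsilon.
Open Scope R_scope.

Record Group := {
  gcar :> Type;
  gmul : gcar -> gcar -> gcar;
  gone : gcar;
  ginv : gcar -> gcar;
  gmulA : forall x y z, gmul x (gmul y z) = gmul (gmul x y) z;
  gmul1 : forall x, gmul gone x = x;
  gmulV : forall x, gmul (ginv x) x = gone
}.
Arguments gmul {g}. Arguments gone {g}. Arguments ginv {g}.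

Section WordMetric.
Context {T : Type} (mul : T -> T -> T) (one : T) (inv : T -> T) (S : T -> Prop).

Definition is_word (w : list T) : Prop :=
  Forall (fun a => S a \/ exists s, S s /\ a = inv s) w.

Definition word_prod (w : list T) : T := fold_right mul one w.

Definition word_len_le (x : T) (n : nat) : Prop :=
  exists w, is_word w /\ (length w <= n)%nat /\ word_prod w = x.

Definition word_length (x : T) : nat :=
  epsilon (inhabits 0%nat)
    (fun n => word_len_le x n /\ forall m, word_len_le x m -> (n <= m)%nat).

Definition word_dist (x y : T) : R := INR (word_length (mul (inv x) y)).
End WordMetric.

Section ANdim.
Context {P : Type} (d : P -> P -> R).

Inductive rchain (Z : P -> Prop) (r : R) : P -> P -> Prop :=
| rchain_refl x : Z x -> rchain Z r x x
| rchain_step x y z : Z x -> d x y < r -> rchain Z r y z -> rchain Z r x z.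

Definition AN_linear_control (Y : P -> Prop) (n : nat) : Prop :=
  exists C : R, C > 0 /\
  forall r : R, r > 0 ->
  exists X : nat -> P -> Prop,
    (forall i x, X i x -> Y x) /\
    (forall x, Y x -> exists i, (i <= n)%nat /\
        forall y, Y y -> d x y < r -> X i y) /\
    (forall i, (i <= n)%nat -> forall y z, rchain (X i) r y z -> d y z <= C * r).

Definition dimAN_eq (Y : P -> Prop) (n : nat) : Prop :=
  AN_linear_control Y n /\ forall m, (m < n)%nat -> ~ AN_linear_control Y m.
End ANdim.

Section Wreath.
Context (G H : Group).

Definition WT : Type := ((G -> H) * G)%type.

Definition fin_supp (f : G -> H) : Prop :=
  exists l : list G, forall g, f g <> gone -> In g l.

Definition wact (b : G) (f : G -> H) : G -> H := fun c => f (gmul (ginv b) c).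

Definition wmul (x y : WT) : WT :=
  (fun c => gmul (fst x c) (wact (snd x) (fst y) c), gmul (snd x) (snd y)).
Definition wone : WT := (fun _ => gone, gone).
Definition winv (x : WT) : WT :=
  (wact (ginv (snd x)) (fun c => ginv (fst x c)), ginv (snd x)).

Definition wreath_elt (x : WT) : Prop := fin_supp (fst x).

Definition wreath_kernel (x : WT) : Prop := fin_supp (fst x) /\ snd x = gone.

Definition wreath_gens (SG : list G) (x : WT) : Prop :=
  (exists h : H, h <> gone /\ snd x = gone /\ fst x gone = h /\
       forall c, c <> gone -> fst x c = gone)
  \/ (exists s, In s SG /\ snd x = s /\ forall c, fst x c = gone).

Definition wreath_dist (SG : list G) : WT -> WT -> R :=
  word_dist wmul wone winv (wreath_gens SG).
End Wreath.

Definition group_dist (G : Group) (SG : list G) : G -> G -> R :=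
  word_dist gmul gone ginv (fun s => In s SG).

(* Main.v *)
Require Import Defs.
From Stdlib Require Import Reals List.
From Stdlib Require Import ZArith Lia Lra Classical ClassicalEpsilon FunctionalExtensionality.
Open Scope R_scope.

(* Lamps lit by a word of length n lie in the ball of radius n, and conversely
   lamps in a finite ball B of G can be lit by walking around a spanning tree of
   B, at a cost linear in |B|.  Hence, if the projection to G of an r-chain in
   the wreath product stays within distance m, the chain has diameter
   O(|B(m + r)|) = O(m + r).  With m = 0 this bounds the r-components of the
   kernel; with m = O(r) it lifts linear control from G to the wreath product.
   For G itself, cover by annuli around the identity of width proportional to r,
   grouped by parity; their components are bounded by a counting argument that
   uses linear growth directly, without the virtually cyclic structure of G.
   Dimension 0 is excluded because 2-chains connect everything while balls are
   finite. *)

(** * Group identities derived from the left axioms *)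

Section GroupLaws.
Context {T : Group}.
Implicit Types x y z : T.

Lemma gmulK x y : gmul (ginv x) (gmul x y) = y.
Proof. now rewrite gmulA, gmulV, gmul1. Qed.

Lemma gmul_cancel x y z : gmul x y = gmul x z -> y = z.
Proof. intros E; rewrite <- (gmulK x y), E; apply gmulK. Qed.

Lemma gmulV_r x : gmul x (ginv x) = gone.
Proof.
rewrite <- (gmul1 _ (gmul x _)), <- (gmulV _ (ginv x)) at 1.
rewrite <- gmulA, (gmulK x); apply gmulV.
Qed.

Lemma gmul1_r x : gmul x gone = x.
Proof. now rewrite <- (gmulV _ x), gmulA, gmulV_r, gmul1. Qed.

Lemma gmulKV x y : gmul x (gmul (ginv x) y) = y.
Proof. now rewrite gmulA, gmulV_r, gmul1. Qed.

Lemma ginvK x : ginv (ginv x) = x.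
Proof. apply (gmul_cancel (ginv x)); now rewrite gmulV_r, gmulV. Qed.

Lemma ginvM x y : ginv (gmul x y) = gmul (ginv y) (ginv x).
Proof.
apply (gmul_cancel (gmul x y)).
now rewrite gmulV_r, <- gmulA, gmulKV, gmulV_r.
Qed.

Lemma ginv1 : ginv (@gone T) = gone.
Proof. now rewrite <- (gmul1_r (ginv gone)), gmulV. Qed.

Lemma ginv_mul_mul x y z :
  gmul (gmul (ginv x) y) (gmul (ginv y) z) = gmul (ginv x) z.
Proof. now rewrite <- gmulA, gmulKV. Qed.

Lemma ginv_mul_inv x y : ginv (gmul (ginv x) y) = gmul (ginv y) x.
Proof. now rewrite ginvM, ginvK. Qed.

Lemma ginv_mul_eq1 x y : gmul (ginv x) y = gone -> x = y.
Proof. intros E; apply (gmul_cancel (ginv x)); now rewrite gmulV. Qed.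

End GroupLaws.

(** * Words, word length and paths in the Cayley graph *)

Section Words.
Context {T : Group} (S : T -> Prop).
Local Open Scope nat_scope.
Implicit Types x y z : T.
Notation letter := (fun a => S a \/ exists s, S s /\ a = ginv s).
Notation word := (is_word ginv S).
Notation prod := (word_prod gmul gone).
Notation wl := (word_len_le gmul gone ginv S).
Notation len := (word_length gmul gone ginv S).

Lemma word_prod_app (u v : list T) : prod (u ++ v) = gmul (prod u) (prod v).
Proof.
induction u as [|a u IH]; simpl; [now rewrite gmul1|].
now rewrite IH, gmulA.
Qed.

Lemma letter_inv a : letter a -> letter (ginv a).
Proof.
intros [Ha|[s [Hs ->]]]; [right; eauto|left; now rewrite ginvK].
Qed.

Lemma wl_one : wl gone 0.
Proof. exists nil; repeat split; [constructor|auto]. Qed.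

Lemma wl_letter a : letter a -> wl a 1.
Proof.
intros Ha; exists (a :: nil); repeat split; simpl; auto using gmul1_r.
constructor; [exact Ha|constructor].
Qed.

Lemma wl_le x m n : wl x m -> m <= n -> wl x n.
Proof. intros [w [Hw [L E]]] Hmn; exists w; repeat split; auto; lia. Qed.

Lemma wl_mul x y m n : wl x m -> wl y n -> wl (gmul x y) (m + n).
Proof.
intros [u [Hu [Lu <-]]] [v [Hv [Lv <-]]]; exists (u ++ v); repeat split.
- now apply Forall_app.
- rewrite length_app; lia.
- apply word_prod_app.
Qed.

Lemma wl_inv x n : wl x n -> wl (ginv x) n.
Proof.
intros [w [Hw [L <-]]]; apply (wl_le _ (length w)); [clear L|exact L].
induction Hw as [|a w Ha _ IH]; simpl.
- rewrite ginv1; apply wl_one.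
- rewrite ginvM; replace (Datatypes.S (length w)) with (length w + 1) by lia.
  apply wl_mul; auto using wl_letter, letter_inv.
Qed.

Lemma wl_split x m n :
  wl x (m + n) -> exists y z, x = gmul y z /\ wl y m /\ wl z n.
Proof.
intros [w [Hw [L <-]]].
exists (prod (firstn m w)), (prod (skipn m w)).
rewrite <- word_prod_app, firstn_skipn; split; [reflexivity|].
rewrite <- (firstn_skipn m w) in Hw; apply Forall_app in Hw as [H1 H2].
split; [exists (firstn m w)|exists (skipn m w)]; repeat split; auto.
- apply firstn_le_length.
- rewrite length_skipn; lia.
Qed.

(** [word_length] is an epsilon choice, meaningful only once some word represents [x]; the least
    length then exists by well-founded induction. *)
Lemma len_spec x n : wl x n -> wl x (len x) /\ len x <= n.
Proof.
intros Hn.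
assert (E : exists k, wl x k /\ forall m, wl x m -> k <= m).
{ revert Hn; induction n as [n IH] using (well_founded_induction Wf_nat.lt_wf).
  intros Hn; destruct (classic (exists m, m < n /\ wl x m)) as [[m [Lm Hm]]|H].
  - eauto.
  - exists n; split; [exact Hn|]; intros m Hm.
    apply Nat.nlt_ge; intros L; apply H; eauto. }
apply (epsilon_spec (inhabits 0)) in E; fold (len x) in E.
destruct E; auto.
Qed.

Lemma len_one : len gone = 0.
Proof. pose proof (proj2 (len_spec _ _ wl_one)); lia. Qed.

Lemma wl_0 x : wl x 0 -> x = gone.
Proof.
intros [[|a w] [_ [L <-]]]; [reflexivity|simpl in L; lia].
Qed.

(** Reading [w] letter by letter traces a path from [gone] in the Cayley graph; its vertices are the
    products of the prefixes. *)
Definition visits (w : list T) (g : T) : Prop :=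
  exists u v, w = u ++ v /\ prod u = g.

Lemma visits_nil g : visits nil g -> g = gone.
Proof.
intros [u [v [E <-]]]; symmetry in E; apply app_eq_nil in E as [-> _].
reflexivity.
Qed.

Lemma visits_cons a w g :
  visits (a :: w) g -> g = gone \/ visits w (gmul (ginv a) g).
Proof.
intros [[|b u] [v [E <-]]]; [now left|right].
injection E as <- E; exists u, v; simpl; now rewrite gmulK.
Qed.

Lemma visits_app_l u v g : visits u g -> visits (u ++ v) g.
Proof.
intros [u1 [u2 [-> E]]]; exists u1, (u2 ++ v); now rewrite app_assoc.
Qed.

(** The detour returns to its starting vertex, so all later prefixes keep their products. *)
Lemma visits_insert u a v g :
  visits (u ++ v) g -> visits (u ++ a :: ginv a :: v) g.
Proof.
intros [p [q [E <-]]].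
apply app_eq_app in E as [l [[-> ->]|[-> ->]]].
- exists p, (l ++ a :: ginv a :: v); now rewrite app_assoc.
- exists (u ++ a :: ginv a :: l), q; rewrite <- app_assoc; split; [reflexivity|].
  rewrite !word_prod_app; simpl; now rewrite gmulKV.
Qed.

(** The path of [v] starts at [gone], which the empty prefix of [w] visits, so some letter is the
    first to leave the visited set. *)
Lemma first_unvisited w v :
  ~ visits w (prod v) ->
  exists v1 a v2,
    v = v1 ++ a :: v2 /\ visits w (prod v1) /\ ~ visits w (prod (v1 ++ a :: nil)).
Proof.
induction v as [|a v IH] using rev_ind; intros H.
- exfalso; apply H; exists nil, w; auto.
- destruct (classic (visits w (prod v))) as [Hv|Hv].
  + exists v, a, nil; auto.
  + destruct (IH Hv) as [v1 [b [v2 [-> HH]]]].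
    exists v1, b, (v2 ++ a :: nil); rewrite <- app_assoc; auto.
Qed.

(* A detour [a, a^-1] to an unvisited neighbour costs two letters per new
   point, as when going around a spanning tree of the ball. *)
Lemma ball_tour n (l : list T) :
  (forall g, wl g n -> In g l) ->
  exists w, word w /\ prod w = gone /\ length w <= 2 * length l /\
    forall g, wl g n -> visits w g.
Proof.
intros Hl; apply NNPP; intros Hno.
(* Without a complete tour, detours could be added forever, giving tours through arbitrarily many
   distinct points of a ball that [l] enumerates. *)
assert (H : forall k, exists w L, word w /\ prod w = gone /\ NoDup L /\
  length L = k /\ length w <= 2 * k /\ forall g, In g L -> visits w g /\ wl g n).
{ induction k as [|k [w [L [Hw [Pw [NL [LL [Lw HL]]]]]]]].
  - exists nil, nil; repeat split; try (now constructor); simpl; try lia.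
    all: contradiction.
  - assert (Lk : length L <= length l).
    { apply NoDup_incl_length; [exact NL|]; intros g Hg; apply Hl, HL, Hg. }
    assert (Hg : exists g, wl g n /\ ~ visits w g).
    { apply NNPP; intros H; apply Hno; exists w; repeat split; auto; [lia|].
      intros g Hg; apply NNPP; intros Hv; apply H; eauto. }
    destruct Hg as [g [[v [Hv [Lv <-]]] Hnv]].
    destruct (first_unvisited _ _ Hnv) as [v1 [a [v2 [-> [[u1 [u2 [-> E]]] Hna]]]]].
    apply Forall_app in Hv as [Hv1 Hv2].
    pose proof (Forall_inv Hv2) as Ha.
    apply Forall_app in Hw as [Hu1 Hu2].
    exists (u1 ++ a :: ginv a :: u2), (prod (v1 ++ a :: nil) :: L).
    repeat split.
    + apply Forall_app; split; [exact Hu1|].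
      constructor; [exact Ha|]; constructor; [now apply letter_inv|exact Hu2].
    + rewrite word_prod_app in *; simpl; now rewrite gmulKV.
    + constructor; [|exact NL]; intros Hin; apply Hna, HL, Hin.
    + simpl; lia.
    + rewrite length_app in *; simpl in *; lia.
    + destruct H as [<-|H].
      * exists (u1 ++ a :: nil), (ginv a :: u2); rewrite <- app_assoc.
        split; [reflexivity|]; now rewrite !word_prod_app, E.
      * apply visits_insert, HL, H.
    + destruct H as [<-|H]; [|apply HL, H].
      exists (v1 ++ a :: nil); repeat split.
      * apply Forall_app; split; [exact Hv1|constructor; [exact Ha|constructor]].
      * rewrite length_app in *; simpl in *; lia. }
destruct (H (Datatypes.S (length l))) as [w [L [_ [_ [NL [LL [_ HL]]]]]]].
assert (length L <= length l); [|lia].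
apply NoDup_incl_length; [exact NL|]; intros g Hg; apply Hl, HL, Hg.
Qed.

Lemma word_rchain (Z : T -> Prop) :
  (forall x a, Z x -> letter a -> Z (gmul x a)) ->
  forall w x, word w -> Z x ->
    rchain (word_dist gmul gone ginv S) Z 2 x (gmul x (prod w)).
Proof.
intros HZ w; induction w as [|a w IH]; intros x Hw Hx; simpl.
- rewrite gmul1_r; now constructor.
- inversion Hw as [|? ? Ha Hw']; subst.
  apply (rchain_step _ _ _ _ (gmul x a)); [exact Hx| |rewrite gmulA; auto].
  unfold word_dist; rewrite gmulK.
  destruct (len_spec _ _ (wl_letter a Ha)) as [_ L].
  apply le_INR in L; simpl in L; lra.
Qed.

End Words.

(** * Chains, and linear control at integer scales *)

Section Chains.
Context {P : Type} (d : P -> P -> R).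

Lemma rchain_mono (X Z : P -> Prop) r s x y :
  (forall p, X p -> Z p) -> r <= s -> rchain d X r x y -> rchain d Z s x y.
Proof.
intros HXZ Hrs H; induction H as [x Hx|x y z Hx Hd _ IH]; [now constructor; auto|].
apply (rchain_step _ _ _ _ y); auto; lra.
Qed.

Lemma rchain_start (Z : P -> Prop) r x y : rchain d Z r x y -> Z x.
Proof. now destruct 1. Qed.

Lemma rchain_end (Z : P -> Prop) r x y : rchain d Z r x y -> Z y.
Proof. induction 1; auto. Qed.

(** With a single covering set, each point lies in that set together with its ball, so the set is
    all of [Y]. *)
Lemma AN_linear_control_0 (Y : P -> Prop) :
  (forall x, d x x = 0) -> AN_linear_control d Y 0 ->
  exists C, forall r, r > 0 -> forall x y, rchain d Y r x y -> d x y <= C * r.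
Proof.
intros Hd0 [C [_ H]]; exists C; intros r Hr x y Hxy.
destruct (H r Hr) as [X [_ [Hcov Hdiam]]].
apply (Hdiam 0%nat); [lia|].
apply (rchain_mono Y _ r); [|lra|exact Hxy].
intros p Hp; destruct (Hcov p Hp) as [i [Hi Hb]].
replace 0%nat with i by lia; apply Hb; [exact Hp|rewrite Hd0; lra].
Qed.

(** Distances are integers, so integer scales suffice. For [r <= 1] chains are constant; for [r > 1]
    the scale [up r] is at most [r + 1 < 2 * r], which gives [2 * c], and the extra 1 keeps the
    constant positive. *)
Lemma AN_linear_control_nat (nd : P -> P -> nat) (Y : P -> Prop) (n c : nat) :
  (forall x y, d x y = INR (nd x y)) ->
  (forall x, nd x x = 0%nat) ->
  (forall x y, Y x -> Y y -> nd x y = 0%nat -> x = y) ->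
  (forall M, (1 <= M)%nat -> exists X : nat -> P -> Prop,
    (forall i x, X i x -> Y x) /\
    (forall x, Y x -> exists i, (i <= n)%nat /\
       forall y, Y y -> (nd x y < M)%nat -> X i y) /\
    (forall i x y, (i <= n)%nat -> rchain d (X i) (INR M) x y ->
       (nd x y <= c * M)%nat)) ->
  AN_linear_control d Y n.
Proof.
intros Hd Hxx Hsep H; exists (2 * INR c + 1).
split; [pose proof (pos_INR c); lra|]; intros r Hr.
destruct (Rle_or_lt r 1) as [Hr1|Hr1].
- exists (fun _ => Y); split; [auto|split].
  + intros x Hx; exists 0%nat; split; [lia|auto].
  + intros i _ x y Hxy; replace y with x.
    { rewrite Hd, Hxx; simpl; pose proof (pos_INR c); nra. }
    induction Hxy as [x Hx|x y z Hx Hxy Hyz IH]; [reflexivity|].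
    rewrite <- IH; apply Hsep; [exact Hx|exact (rchain_start _ _ _ _ Hyz)|].
    rewrite Hd in Hxy; assert (L : (nd x y < 1)%nat); [|lia].
    apply INR_lt; simpl; lra.
- destruct (archimed r) as [U1 U2].
  assert (U0 : (1 <= up r)%Z) by (apply le_IZR; lra).
  assert (UM : INR (Z.to_nat (up r)) = IZR (up r)).
  { rewrite INR_IZR_INZ, Z2Nat.id; [reflexivity|lia]. }
  set (M := Z.to_nat (up r)) in *.
  destruct (H M) as [X [XY [Hcov Hdiam]]]; [unfold M; lia|].
  exists X; split; [exact XY|split].
  + intros x Hx; destruct (Hcov x Hx) as [i [Hi Hb]]; exists i; split; [exact Hi|].
    intros y Hy Hxy; apply Hb; [exact Hy|]; rewrite Hd in Hxy.
    apply INR_lt; lra.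
  + intros i Hi x y Hxy.
    assert (L : (nd x y <= c * M)%nat).
    { apply (Hdiam i); [exact Hi|]; apply (rchain_mono (X i) _ r); auto; lra. }
    apply le_INR in L; rewrite mult_INR in L; rewrite Hd.
    pose proof (pos_INR c); nra.
Qed.

End Chains.

(** Spelling a word from [x] is a 2-chain, since letters have length at most 1; control at scale 2
    then bounds the length of every element that has a word. *)
Lemma AN_linear_control_0_bounded {T : Group} (S Y : T -> Prop) (x : T) :
  Y x ->
  (forall y a, Y y -> S a \/ (exists s, S s /\ a = ginv s) -> Y (gmul y a)) ->
  AN_linear_control (word_dist gmul gone ginv S) Y 0 ->
  exists n, forall g m,
    word_len_le gmul gone ginv S g m -> word_len_le gmul gone ginv S g n.
Proof.
intros Hx HY HC; apply AN_linear_control_0 in HC as [C HC].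
2: { intros y; unfold word_dist; now rewrite gmulV, len_one. }
destruct (INR_unbounded (C * 2)) as [n Hn]; exists n; intros g m Hg.
apply (wl_le _ _ _ _ (proj1 (len_spec _ _ _ Hg))).
destruct Hg as [w [Hw [_ <-]]].
pose proof (HC 2 ltac:(lra) _ _ (word_rchain S Y HY w x Hw Hx)) as L.
unfold word_dist in L; rewrite gmulK in L; apply INR_le; lra.
Qed.

(** * The wreath product as a group *)

Section WreathGroup.
Context (G H : Group).

Lemma wmulA (x y z : WT G H) : wmul G H x (wmul G H y z) = wmul G H (wmul G H x y) z.
Proof.
unfold wmul, wact; simpl; f_equal; [|apply gmulA].
extensionality c; now rewrite ginvM, !gmulA.
Qed.

Lemma wmul1 (x : WT G H) : wmul G H (wone G H) x = x.
Proof.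
destruct x as [f b]; unfold wmul, wone, wact; simpl; f_equal; [|apply gmul1].
extensionality c; now rewrite ginv1, !gmul1.
Qed.

Lemma wmulV (x : WT G H) : wmul G H (winv G H x) x = wone G H.
Proof.
unfold wmul, wone, winv, wact; simpl; f_equal; [|apply gmulV].
extensionality c; apply gmulV.
Qed.

(** This is the unrestricted product, with all functions as lamp configurations, so that the lemmas
    on groups apply directly; finite support is carried separately by [wreath_elt]. *)
Definition wreath_group : Group :=
  Build_Group (WT G H) (wmul G H) (wone G H) (winv G H) wmulA wmul1 wmulV.

End WreathGroup.

(** * Lamp supports and word length in the wreath product *)

Section WreathLength.
Context (G H : Group) (SG : list G).
Local Open Scope nat_scope.
Notation W := (wreath_group G H).
Notation SGp := (fun s : G => In s SG).
Notation SW := (wreath_gens G H SG : W -> Prop).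
Notation wlG := (word_len_le gmul gone ginv SGp).
Notation wlW := (word_len_le (@gmul W) (@gone W) (@ginv W) SW).
Notation word := (is_word ginv SGp).
Notation prod := (word_prod gmul gone).

Lemma wl_snd (x : W) n : wlW x n -> wlG (snd x) n.
Proof.
intros [w [Hw [L <-]]]; apply (wl_le _ _ (length w)); [clear L|exact L].
assert (HS : forall s : W, SW s -> wlG (snd s) 1).
{ intros s [[h [_ [E _]]]|[t [Ht [E _]]]]; rewrite E.
  - apply (wl_le _ _ 0); [apply wl_one|lia].
  - apply wl_letter; now left. }
induction Hw as [|a w Ha _ IH]; [apply wl_one|].
apply (wl_mul _ (snd a) _ 1); [|exact IH].
destruct Ha as [Ha|[s [Hs ->]]]; [now apply HS|].
apply (wl_inv _ (snd s)), HS, Hs.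
Qed.

Definition lit_within (x : W) (n : nat) : Prop :=
  forall c, fst x c <> gone -> wlG c n.

(** A lamp lit in the product is lit in [x], or is a lamp of [y] translated by [snd x], which moves
    it by at most [m]. *)
Lemma lit_within_mul (x y : W) m n :
  lit_within x (m + n) -> lit_within y n -> wlG (snd x) m ->
  lit_within (gmul x y) (m + n).
Proof.
intros Hx Hy Sx c Hc.
destruct (classic (fst x c = gone)) as [E|E]; [|now apply Hx].
change (gmul (fst x c) (fst y (gmul (ginv (snd x)) c)) <> gone) in Hc.
rewrite E, gmul1 in Hc; apply Hy in Hc.
rewrite <- (gmulKV (snd x) c); now apply wl_mul.
Qed.

Lemma lit_within_le (x : W) m n : lit_within x m -> m <= n -> lit_within x n.
Proof. intros Hx L c Hc; apply (wl_le _ _ m); auto. Qed.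

Lemma lit_within_letter (a : W) :
  SW a \/ (exists s, SW s /\ a = ginv s) -> lit_within a 1.
Proof.
assert (HS : forall s : W, SW s -> lit_within s 0).
{ intros s [[h [_ [_ [_ E]]]]|[t [_ [_ E]]]] c Hc.
  - replace c with (@gone G); [apply wl_one|].
    apply NNPP; intros Hn; apply Hc, E; auto.
  - now contradict Hc. }
intros [Ha|[s [Hs ->]]]; [apply (lit_within_le _ 0); auto|].
intros c Hc.
change (ginv (fst s (gmul (ginv (ginv (snd s))) c)) <> gone) in Hc.
rewrite ginvK in Hc.
assert (E : fst s (gmul (snd s) c) <> gone).
{ intros E; apply Hc; now rewrite E, ginv1. }
apply (HS s Hs), wl_0 in E.
replace c with (ginv (snd s)).
- apply wl_inv, wl_snd, wl_letter; now left.
- apply (gmul_cancel (snd s)); now rewrite E, gmulV_r.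
Qed.

Lemma wl_lit (x : W) n : wlW x n -> lit_within x n.
Proof.
intros [w [Hw [L <-]]]; apply (lit_within_le _ (length w)); [clear L|exact L].
induction Hw as [|a w Ha Hw IH]; [intros c Hc; now contradict Hc|].
apply (lit_within_mul _ _ 1); [|exact IH|].
- apply (lit_within_le _ 1); [now apply lit_within_letter|lia].
- apply wl_snd, wl_letter, Ha.
Qed.

Lemma wl_lamp (h : H) (f : G -> H) :
  f gone = h -> (forall c, c <> gone -> f c = gone) -> wlW (f, gone) 1.
Proof.
intros E0 E; destruct (classic (h = gone)) as [Eh|Nh].
- replace (f, gone) with (@gone W); [apply (wl_le _ _ 0); [apply wl_one|lia]|].
  apply (f_equal (fun g => (g, gone))); extensionality c.
  destruct (classic (c = gone)) as [->|Hc]; [congruence|now rewrite E].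
- apply wl_letter; left; left; exists h; auto.
Qed.

Lemma wl_lift (a : G) :
  In a SG \/ (exists s, In s SG /\ a = ginv s) -> wlW (fun _ => gone, a) 1.
Proof.
intros Ha; apply wl_letter; destruct Ha as [Ha|[s [Hs ->]]].
- left; right; exists a; auto.
- right; exists (fun _ => gone, s); split; [right; exists s; auto|].
  apply (f_equal (fun g => (g, ginv s))); extensionality c; symmetry; apply ginv1.
Qed.

(* The lamplighter follows [w] and adjusts one lamp at each stop. *)
Lemma wl_walk w f :
  word w -> (forall c, f c <> gone -> visits w c) ->
  wlW (f, prod w) (2 * length w + 1).
Proof.
intros Hw; revert f; induction Hw as [|a w Ha Hw IH]; intros f Hf.
- apply (wl_lamp (f gone)); [reflexivity|]; intros c Hc.
  apply NNPP; intros E; apply Hc, visits_nil, Hf, E.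
(* [f0] is the lamp at the current position. [f1] is the rest of the configuration as seen after
   moving by [a], with the lamp already set blanked out in case the path returns to it. *)
- set (f0 := fun c => if excluded_middle_informative (c = gone) then f c else gone).
  set (f1 := fun c => if excluded_middle_informative (gmul a c = gone) then gone
                      else f (gmul a c)).
  assert (E : (f, prod (a :: w)) =
    @gmul W (f0, gone) (@gmul W (fun _ => gone, a) (f1, prod w))).
  { unfold gmul at 2 3; simpl; unfold wmul, wact; simpl; rewrite gmul1.
    apply (f_equal (fun g => (g, _))); extensionality c.
    rewrite ginv1, !gmul1; unfold f0, f1; rewrite gmulKV.
    destruct (excluded_middle_informative (c = gone)); [now rewrite gmul1_r|].
    now rewrite gmul1. }
  rewrite E; apply (wl_le _ _ (1 + (1 + (2 * length w + 1)))); [|simpl; lia].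
  apply wl_mul; [|apply wl_mul; [now apply wl_lift|]].
  + apply (wl_lamp (f gone)); unfold f0.
    * now destruct (excluded_middle_informative (gone = gone)).
    * intros c Hc; now destruct (excluded_middle_informative (c = gone)).
  + apply IH; unfold f1; intros c Hc.
    destruct (excluded_middle_informative (gmul a c = gone)); [easy|].
    destruct (visits_cons _ _ _ (Hf _ Hc)) as [E'|E']; [contradiction|].
    now rewrite gmulK in E'.
Qed.

(** Tour the ball and return, then walk to [snd x]: at most [2 * length l + m] moves, with one lamp
    adjustment at each stop. *)
Lemma wl_lit_within (x : W) n m (l : list G) :
  (forall g, wlG g n -> In g l) -> lit_within x n -> wlG (snd x) m ->
  wlW x (2 * (2 * length l + m) + 1).
Proof.
intros Hl Hx [v [Hv [Lv Ev]]].
destruct (ball_tour _ n l Hl) as [w [Hw [Pw [Lw HV]]]].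
replace x with (fst x, prod (w ++ v)).
- apply (wl_le _ _ (2 * length (w ++ v) + 1)); [|rewrite length_app; lia].
  apply wl_walk; [now apply Forall_app|]; intros c Hc.
  apply visits_app_l, HV, Hx, Hc.
- rewrite word_prod_app, Pw, gmul1, Ev; now destruct x.
Qed.

Lemma wreath_generated (x : W) :
  (forall g, exists n, wlG g n) ->
  (forall n, exists l : list G, forall g, wlG g n -> In g l) ->
  wreath_elt G H x -> exists n, wlW x n.
Proof.
intros Hgen Hball [s Hs].
assert (B : exists n, forall g, In g s -> wlG g n).
{ clear Hs; induction s as [|a s [n IH]]; [exists 0; easy|].
  destruct (Hgen a) as [m Hm]; exists (m + n); intros g [<-|Hg].
  - apply (wl_le _ _ m); [exact Hm|lia].
  - apply (wl_le _ _ n); [auto|lia]. }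
destruct B as [n Hn], (Hball n) as [l Hl], (Hgen (snd x)) as [m Hm].
eexists; apply (wl_lit_within x n m l); auto; intros c Hc; auto.
Qed.

Lemma wreath_elt_div (x y : W) :
  wreath_elt G H x -> wreath_elt G H y -> wreath_elt G H (gmul (ginv x) y).
Proof.
intros [l Hl] [k Hk]; exists (map (gmul (ginv (snd x))) (l ++ k)); intros c Hc.
change (gmul (ginv (fst x (gmul (ginv (ginv (snd x))) c)))
             (fst y (gmul (ginv (ginv (snd x))) c)) <> gone) in Hc.
rewrite ginvK in Hc.
rewrite <- (gmulK (snd x) c); apply in_map, in_or_app.
destruct (classic (fst x (gmul (snd x) c) = gone)) as [E|E]; [right|left; auto].
apply Hk; intros E'; apply Hc; now rewrite E, E', ginv1, gmul1.
Qed.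

(** Everything is measured from the endpoint [z]. A step from [x] to [y] changes only lamps within
    [M] of the position of [y], which is within [m] of that of [z]; hence the radius does not grow
    with the number of steps. *)
Lemma lit_within_rchain (Z : W -> Prop) M m (x z : W) :
  (forall g, exists n, wlG g n) ->
  (forall n, exists l : list G, forall g, wlG g n -> In g l) ->
  (forall y, Z y -> wreath_elt G H y) ->
  rchain (wreath_dist G H SG) Z (INR M) x z ->
  (forall y, rchain (wreath_dist G H SG) Z (INR M) y z ->
     wlG (gmul (ginv (snd z)) (snd y)) m) ->
  lit_within (gmul (ginv z) x) (m + M).
Proof.
intros Hgen Hball HZ HC; induction HC as [x Hx|x y z Hx Hd Hyz IH]; intros Hm.
- rewrite gmulV; intros c Hc; now contradict Hc.
- rewrite <- (@ginv_mul_mul W z y x); apply lit_within_mul; [now apply IH| |now apply Hm].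
  destruct (wreath_generated (@gmul W (@ginv W x) y)) as [n Hn]; auto.
  { apply wreath_elt_div; [auto|]; apply HZ, (rchain_start _ _ _ _ _ Hyz). }
  rewrite <- (@ginv_mul_inv W).
  apply wl_lit, wl_inv; apply len_spec in Hn as [Hn _]; apply (wl_le _ _ _ _ Hn).
  apply Nat.lt_le_incl, INR_lt, Hd.
Qed.

End WreathLength.

(** Counting tool for the annulus argument, where it is nested three deep: over scales, depths and
    chain points. *)
Lemma NoDup_disjoint_union {A} (P : nat -> A -> Prop) n m :
  (forall i, (i < n)%nat -> exists l, NoDup l /\ length l = m /\ forall q, In q l -> P i q) ->
  (forall i k q, (i < k < n)%nat -> P i q -> P k q -> False) ->
  exists l, NoDup l /\ length l = (n * m)%nat /\
    forall q, In q l -> exists i, (i < n)%nat /\ P i q.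
Proof.
induction n as [|n IH]; intros Hex Hdis.
- exists nil; repeat split; [constructor|easy].
- destruct IH as [l [Nl [Ll Hl]]].
  { intros i Hi; apply Hex; lia. }
  { intros i k q Hi; apply Hdis; lia. }
  destruct (Hex n) as [l' [Nl' [Ll' Hl']]]; [lia|].
  exists (l' ++ l); repeat split.
  + apply NoDup_app; auto; intros q Hq Hq'.
    destruct (Hl q Hq') as [i [Hi HP]]; apply (Hdis i n q); [lia|exact HP|auto].
  + rewrite length_app; lia.
  + intros q Hq; apply in_app_or in Hq as [Hq|Hq].
    * exists n; split; [lia|auto].
    * destruct (Hl q Hq) as [i [Hi HP]]; exists i; split; [lia|exact HP].
Qed.

(** * Annuli in groups of linear growth *)

Section LinearGrowth.
Context {G : Group} (S : G -> Prop).
Local Open Scope nat_scope.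
Notation len := (word_length gmul gone ginv S).
Notation nd x y := (len (gmul (ginv x) y)).
Notation dist := (word_dist gmul gone ginv S).
Hypothesis generated : forall g, exists n, word_len_le gmul gone ginv S g n.

Lemma wl_len x : word_len_le gmul gone ginv S x (len x).
Proof. destruct (generated x) as [n Hn]; apply (len_spec _ _ _ Hn). Qed.

Lemma len_le x n : word_len_le gmul gone ginv S x n -> len x <= n.
Proof. intros Hn; apply (len_spec _ _ _ Hn). Qed.

Lemma len_mul x y : len (gmul x y) <= len x + len y.
Proof. apply len_le, wl_mul; apply wl_len. Qed.

Lemma len_inv x : len (ginv x) = len x.
Proof.
apply Nat.le_antisymm; [|rewrite <- (ginvK x) at 1].
all: apply len_le, wl_inv, wl_len.
Qed.

Lemma nd_sym x y : nd x y = nd y x.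
Proof. now rewrite <- ginv_mul_inv, len_inv. Qed.

Lemma nd_tri x y z : nd x z <= nd x y + nd y z.
Proof. rewrite <- (ginv_mul_mul x y z); apply len_mul. Qed.

Lemma len_nd x y : len y <= len x + nd x y.
Proof. rewrite <- (gmulKV x y) at 1; apply len_mul. Qed.

Lemma geodesic_to_one x n :
  n <= len x -> exists q, len q = n /\ nd x q = len x - n.
Proof.
intros Hn; destruct (wl_split S x n (len x - n)) as [q [p [E [Hq Hp]]]].
{ replace (n + (len x - n)) with (len x) by lia; apply wl_len. }
apply len_le in Hq, Hp.
pose proof (len_mul q p) as L; rewrite <- E in L.
exists q; split; [lia|].
rewrite nd_sym, E, gmulK, <- E; lia.
Qed.

(** Discrete intermediate value property: each step changes the distance to [o] by less than [M], so
    no value is overshot by more. *)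
Lemma rchain_at_distance (Z : G -> Prop) M o x y s :
  rchain dist Z (INR M) x y -> nd o x <= s <= nd o y ->
  exists p, Z p /\ s <= nd o p <= s + M.
Proof.
intros HC; induction HC as [x Hx|x y z Hx Hd HC IH]; intros [L1 L2].
- exists x; split; [exact Hx|lia].
- destruct (le_lt_dec (nd o y) s) as [L|L]; [apply IH; auto|].
  apply INR_lt in Hd; pose proof (nd_tri o x y).
  exists y; split; [exact (rchain_start _ _ _ _ _ HC)|lia].
Qed.

Context (A : nat) (growth : forall n, exists l : list G,
  (forall g, len g <= n -> In g l) /\ length l <= A * (n + 1)).

Lemma NoDup_ball_length o n (L : list G) :
  NoDup L -> (forall q, In q L -> nd o q <= n) -> length L <= A * (n + 1).
Proof.
intros NL HL; destruct (growth n) as [l [Hl Ll]].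
apply (Nat.le_trans _ (length l)); [|exact Ll].
rewrite <- (length_map (gmul o) l); apply NoDup_incl_length; [exact NL|].
intros q Hq; rewrite <- (gmulKV o q); apply in_map, Hl, HL, Hq.
Qed.

(* Suppose a component contains points far apart.  For each dyadic depth
   [2^j M], pick [2^(J-j)] points of the chain at mutual distance about
   [8 2^j M] and follow geodesics from them towards [gone] at depths between
   [2^j M] and [2^(j+1) M].  This gives [2^J M] distinct points for each of the
   [J] scales, all in a ball of radius [10 2^J M], which linear growth forbids
   once [J > 11 A]. *)
Lemma annulus_component_bounded :
  exists K, forall M R (Z : G -> Prop), 1 <= M ->
    (forall g, Z g -> R <= len g < R + M) ->
    forall x y, rchain dist Z (INR M) x y -> nd x y <= K * M.
Proof.
set (J := 11 * A + 1); exists (8 * 2 ^ J); intros M R Z HM HZ x y HC.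
apply Nat.nlt_ge; intros Hfar.
pose proof (HZ _ (rchain_start _ _ _ _ _ HC)) as Rx.
pose proof (HZ _ (rchain_end _ _ _ _ _ HC)) as Ry.
(* If [R < 2 ^ J * M], the triangle inequality through [gone] already bounds [nd x y]. Otherwise all
   depths used below are at most [R], so the natural subtraction in [P3] never truncates. *)
destruct (le_lt_dec (2 ^ J * M) R) as [HR|HR].
2: { pose proof (len_mul (ginv x) y); rewrite len_inv in *.
     assert (1 <= 2 ^ J) by (apply Nat.neq_0_lt_0, Nat.pow_nonzero; lia); nia. }
(* Here [j] is the scale, [2 ^ j * M + u] the depth of [q] below level [R], and [i] the index of the
   chain point [p] whose geodesic passes through [q]. Each scale has [2 ^ j * M] depths and
   [2 ^ (J - j)] chain points, so the product does not depend on [j]. *)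
set (P3 := fun j u i q => exists p, Z p /\
  i * (8 * 2 ^ j * M) <= nd x p <= i * (8 * 2 ^ j * M) + M /\
  len q = R - (2 ^ j * M + u) /\ nd p q <= M + 2 * 2 ^ j * M).
set (P2 := fun j u q => exists i, i < 2 ^ (J - j) /\ P3 j u i q).
set (P1 := fun j q => exists u, u < 2 ^ j * M /\ P2 j u q).
assert (pow_split : forall j, j < J -> 2 ^ j * 2 ^ (J - j) = 2 ^ J /\ 1 <= 2 ^ j /\
   1 <= 2 ^ (J - j)).
{ intros j Hj; rewrite <- Nat.pow_add_r; split; [f_equal; lia|].
  split; apply Nat.neq_0_lt_0, Nat.pow_nonzero; lia. }
assert (pow_half : forall j, j < J -> 2 * 2 ^ j <= 2 ^ J).
{ intros j Hj; change (2 ^ Datatypes.S j <= 2 ^ J); apply Nat.pow_le_mono_r; lia. }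
destruct (NoDup_disjoint_union P1 J (2 ^ J * M)) as [L [NL [LL HL]]].
- intros j Hj; destruct (pow_split j Hj) as [Ej [Pj Qj]]; pose proof (pow_half j Hj).
  replace (2 ^ J * M) with (2 ^ j * M * 2 ^ (J - j)) by nia.
  apply (NoDup_disjoint_union (P2 j)).
  + intros u Hu; rewrite <- (Nat.mul_1_r (2 ^ (J - j))).
    apply (NoDup_disjoint_union (P3 j u)).
    * intros i Hi.
      destruct (rchain_at_distance Z M x x y (i * (8 * 2 ^ j * M)) HC)
        as [p [Zp Hp]].
      { rewrite gmulV, len_one; split; [lia|].
        assert (i * 2 ^ j <= 2 ^ J) by nia; nia. }
      pose proof (HZ p Zp).
      destruct (geodesic_to_one p (R - (2 ^ j * M + u))) as [q [Lq Hq]]; [lia|].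
      exists (q :: nil); repeat split; [repeat constructor; easy|].
      intros q' [<-|[]]; exists p; repeat split; auto; try lia; nia.
    (* The chain points are at least [7 * 2 ^ j * M] apart, while each is within [3 * 2 ^ j * M] of
       [q], so their geodesics cannot share [q]. *)
    * intros i k q [Hik _] [p [_ [Hp [_ Hpq]]]] [p' [_ [Hp' [_ Hpq']]]].
      pose proof (nd_tri x p p'); pose proof (nd_tri p q p').
      rewrite (nd_sym p' q) in Hpq'.
      assert ((i + 1) * (8 * 2 ^ j * M) <= k * (8 * 2 ^ j * M))
        by (apply Nat.mul_le_mono_r; lia).
      nia.
  + intros u v q Huv [i [_ [p [_ [_ [E _]]]]]] [i' [_ [p' [_ [_ [E' _]]]]]].
    nia.
- intros j k q Hjk [u [Hu [i [_ [p [_ [_ [E _]]]]]]]]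
    [v [Hv [i' [_ [p' [_ [_ [E' _]]]]]]]].
  assert (2 * 2 ^ j <= 2 ^ k).
  { change (2 ^ Datatypes.S j <= 2 ^ k); apply Nat.pow_le_mono_r; lia. }
  assert (2 * 2 ^ k <= 2 ^ J) by (apply pow_half; lia).
  nia.
(* The bound is at most [11 * A * 2 ^ J * M], the summand 1 being absorbed by [2 ^ J * M]; this is
   less than the [J * 2 ^ J * M] points of [L]. *)
- assert (length L <= A * (10 * 2 ^ J * M + 1)) as HB.
  { apply (NoDup_ball_length x); [exact NL|]; intros q Hq.
    destruct (HL q Hq) as [j [Hj [u [Hu [i [Hi [p [_ [Hp [_ Hpq]]]]]]]]]].
    destruct (pow_split j Hj) as [Ej [Pj Qj]]; pose proof (pow_half j Hj).
    pose proof (nd_tri x p q).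
    assert (i * 2 ^ j + 2 ^ j <= 2 ^ J) by nia.
    nia. }
  assert (1 <= 2 ^ J) by (apply Nat.neq_0_lt_0, Nat.pow_nonzero; lia).
  rewrite LL in HB; unfold J in HB at 1; nia.
Qed.

(** Consecutive annuli overlap in width [2 * M], enough for each open [M]-ball to fit in one of
    them; annuli of the same parity are separated by a gap of [M], which no step shorter than [M]
    crosses. *)
Definition annulus (M k : nat) (g : G) : Prop :=
  3 * M * k <= len g < 3 * M * k + 5 * M.

Lemma rchain_annulus M i x y :
  rchain dist (fun g => exists k, annulus M (2 * k + i) g) (INR M) x y ->
  exists k, rchain dist (annulus M (2 * k + i)) (INR M) x y.
Proof.
intros HC; induction HC as [x [k Hx]|x y z [k Hx] Hd _ [k' IH]].
- exists k; now constructor.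
- exists k'; apply (rchain_step _ _ _ _ y); [|exact Hd|exact IH].
  apply INR_lt in Hd.
  pose proof (rchain_start _ _ _ _ _ IH) as Hy; unfold annulus in *.
  pose proof (len_nd x y); pose proof (len_nd y x); rewrite (nd_sym y x) in *.
  destruct (Nat.lt_trichotomy k k') as [L|[<-|L]]; [exfalso|exact Hx|exfalso]; nia.
Qed.

Lemma linear_growth_cover :
  exists K, forall M, 1 <= M -> exists X : nat -> G -> Prop,
    (forall x, exists i, i <= 1 /\ forall y, nd x y < M -> X i y) /\
    (forall i x y, rchain dist (X i) (INR M) x y -> nd x y <= K * M).
Proof.
destruct annulus_component_bounded as [K HK]; exists (5 * K); intros M HM.
exists (fun i g => exists k, annulus M (2 * k + i) g); split.
(* [lo] bounds from below the lengths in the open [M]-ball at [x], cut off at 0; these lengths span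
   at most [2 * M - 1] values from [lo], and [lo] lies in the first [3 * M] of annulus [k]. *)
- intros x; set (lo := len x - (M - 1)).
  set (k := lo / (3 * M)).
  pose proof (Nat.div_mod lo (3 * M) ltac:(lia)) as E; fold k in E.
  pose proof (Nat.mod_upper_bound lo (3 * M) ltac:(lia)).
  pose proof (Nat.div_mod k 2 ltac:(lia)) as Ek.
  pose proof (Nat.mod_upper_bound k 2 ltac:(lia)).
  exists (k mod 2); split; [lia|]; intros y Hy; exists (k / 2).
  rewrite <- Ek; unfold annulus.
  pose proof (len_nd x y); pose proof (len_nd y x); rewrite (nd_sym y x) in *.
  lia.
- intros i x y HC; apply rchain_annulus in HC as [k HC].
  (* The annulus has width [5 * M], so its [M]-chains are treated as chains at scale [5 * M]. *)
  replace (5 * K * M) with (K * (5 * M)) by lia.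
  apply (HK (5 * M) (3 * M * (2 * k + i)) (annulus M (2 * k + i))); [lia|auto|].
  apply (rchain_mono _ (annulus M (2 * k + i)) _ (INR M)); auto.
  apply le_INR; lia.
Qed.

End LinearGrowth.

(** * Control of the kernel, the group and the wreath product *)

Section WreathControl.
Context (G H : Group) (SG : list G).
Local Open Scope nat_scope.
Notation W := (wreath_group G H).
Notation SGp := (fun s : G => In s SG).
Notation lenG := (word_length gmul gone ginv SGp).
Notation ndG x y := (lenG (gmul (ginv x) y)).
Notation lenW := (word_length (@gmul W) (@gone W) (@ginv W) (wreath_gens G H SG)).
Notation ndW x y := (lenW (@gmul W (@ginv W x) y)).
Notation wlW := (word_len_le (@gmul W) (@gone W) (@ginv W) (wreath_gens G H SG)).
Hypothesis generated : forall g, exists n, word_len_le gmul gone ginv SGp g n.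
Context (A : nat) (growth : forall n, exists l : list G,
  (forall g, lenG g <= n -> In g l) /\ length l <= A * (n + 1)).

Lemma finite_balls n :
  exists l : list G, forall g, word_len_le gmul gone ginv SGp g n -> In g l.
Proof.
destruct (growth n) as [l [Hl _]]; exists l; intros g Hg.
apply Hl, len_le; auto.
Qed.

Lemma wreath_div_generated (x y : W) :
  wreath_elt G H x -> wreath_elt G H y -> exists n, wlW (gmul (ginv x) y) n.
Proof.
intros Hx Hy; apply wreath_generated; [exact generated|exact finite_balls|].
now apply wreath_elt_div.
Qed.

Lemma ndG_le_ndW (x y : W) :
  wreath_elt G H x -> wreath_elt G H y -> ndG (snd x) (snd y) <= ndW x y.
Proof.
intros Hx Hy; destruct (wreath_div_generated x y Hx Hy) as [n Hn].
apply len_spec in Hn as [Hn _]; apply wl_snd in Hn; apply len_le; auto.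
Qed.

Lemma ndW_0 (x y : W) :
  wreath_elt G H x -> wreath_elt G H y -> ndW x y = 0 -> x = y.
Proof.
intros Hx Hy E; destruct (wreath_div_generated x y Hx Hy) as [n Hn].
apply len_spec in Hn as [Hn _]; rewrite E in Hn.
apply (@ginv_mul_eq1 W), (wl_0 _ _ Hn).
Qed.

(** The lamps of the quotient of [x] and [z] lie in a ball of radius [m + M], which has at most
    [A * (m + M + 1)] points; touring it gives the bound. *)
Lemma wreath_chain_length (Z : W -> Prop) M m (x z : W) :
  (forall y, Z y -> wreath_elt G H y) ->
  rchain (wreath_dist G H SG) Z (INR M) x z ->
  (forall y, rchain (wreath_dist G H SG) Z (INR M) y z -> ndG (snd y) (snd z) <= m) ->
  ndW x z <= 2 * (2 * (A * (m + M + 1)) + m) + 1.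
Proof.
intros HZ HC Hm.
assert (Hm' : forall y, rchain (wreath_dist G H SG) Z (INR M) y z ->
   word_len_le gmul gone ginv SGp (gmul (ginv (snd z)) (snd y)) m).
{ intros y Hy; apply (wl_le _ _ (ndG (snd z) (snd y))); [now apply wl_len|].
  rewrite nd_sym; auto. }
destruct (growth (m + M)) as [l [Hl Ll]].
apply (Nat.le_trans _ (2 * (2 * length l + m) + 1)); [|lia].
assert (HW : wlW (gmul (ginv z) x) (2 * (2 * length l + m) + 1)).
{ apply (wl_lit_within _ _ _ _ (m + M)).
  - intros g Hg; apply Hl, len_le; auto.
  - apply (lit_within_rchain _ _ _ Z); auto using finite_balls.
  - apply (Hm' x HC). }
apply wl_inv in HW; rewrite ginv_mul_inv in HW.
apply (len_spec _ _ _ HW).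
Qed.

Lemma rchain_snd (X : W -> Prop) (Z : G -> Prop) r (x y : W) :
  (forall p, X p -> wreath_elt G H p /\ Z (snd p)) ->
  rchain (wreath_dist G H SG) X r x y ->
  rchain (group_dist G SG) Z r (snd x) (snd y).
Proof.
intros HX HC; induction HC as [x Hx|x y z Hx Hd HC IH].
- constructor; now apply HX.
- apply (rchain_step _ _ _ _ (snd y)); [now apply HX| |exact IH].
  apply (Rle_lt_trans _ (wreath_dist G H SG x y)); [|exact Hd].
  apply le_INR, ndG_le_ndW; apply HX; [exact Hx|exact (rchain_start _ _ _ _ _ HC)].
Qed.

(** In the kernel the position is constant, so chains have [m = 0] and the one-set cover works. *)
Lemma wreath_kernel_control :
  AN_linear_control (wreath_dist G H SG) (wreath_kernel G H) 0.
Proof.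
apply (AN_linear_control_nat _ (fun x y : W => ndW x y) _ _ (8 * A + 1)).
- reflexivity.
- intros x; rewrite gmulV; apply len_one.
- intros x y [Hx _] [Hy _]; now apply ndW_0.
- intros M HM; exists (fun _ => wreath_kernel G H); split; [auto|split].
  + intros x Hx; exists 0; auto.
  + intros _ x y _ HC.
    apply (Nat.le_trans _ (2 * (2 * (A * (0 + M + 1)) + 0) + 1)); [|nia].
    apply (wreath_chain_length (wreath_kernel G H)); [now intros z [Hz _]|exact HC|].
    intros z Hz; rewrite (proj2 (rchain_start _ _ _ _ _ Hz)).
    rewrite (proj2 (rchain_end _ _ _ _ _ Hz)), gmulV, len_one; auto.
Qed.

Lemma group_control : AN_linear_control (group_dist G SG) (fun _ => True) 1.
Proof.
destruct (linear_growth_cover SGp generated A growth) as [K HK].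
apply (AN_linear_control_nat _ (fun x y : G => ndG x y) _ _ K).
- reflexivity.
- intros x; rewrite gmulV; apply len_one.
- intros x y _ _ E; apply ginv_mul_eq1, (wl_0 SGp); rewrite <- E; now apply wl_len.
- intros M HM; destruct (HK M HM) as [X [Hcov Hdiam]]; exists X.
  split; [auto|split; [|now intros; apply (Hdiam i)]].
  intros x _; destruct (Hcov x) as [i [Hi Hb]]; exists i; auto.
Qed.

(** The cover of [G] is pulled back along the projection, which does not increase distances; chains
    in a piece thus project to chains of diameter at most [K * M]. *)
Lemma wreath_control : AN_linear_control (wreath_dist G H SG) (wreath_elt G H) 1.
Proof.
destruct (linear_growth_cover SGp generated A growth) as [K HK].
apply (AN_linear_control_nat _ (fun x y : W => ndW x y) _ _
         (2 * (2 * (A * (K + 2)) + K) + 1)).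
- reflexivity.
- intros x; rewrite gmulV; apply len_one.
- exact ndW_0.
- intros M HM; destruct (HK M HM) as [X [Hcov Hdiam]].
  exists (fun i x => wreath_elt G H x /\ X i (snd x)).
  split; [now intros i x []|split].
  + intros x Hx; destruct (Hcov (snd x)) as [i [Hi Hb]]; exists i; split; [exact Hi|].
    intros y Hy Hxy; split; [exact Hy|]; apply Hb.
    apply (Nat.le_lt_trans _ (ndW x y)); [now apply ndG_le_ndW|exact Hxy].
  + intros i x y Hi HC.
    apply (Nat.le_trans _ (2 * (2 * (A * (K * M + M + 1)) + K * M) + 1)); [|nia].
    apply (wreath_chain_length _ _ _ _ _ (fun z Hz => proj1 Hz) HC).
    intros z Hz; apply (Hdiam i).
    now apply (rchain_snd _ (X i) _ _ _ (fun p Hp => Hp)).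
Qed.

Hypothesis infinite : ~ exists l : list G, forall g : G, In g l.

Lemma group_no_control_0 : ~ AN_linear_control (group_dist G SG) (fun _ => True) 0.
Proof.
intros HC; apply (AN_linear_control_0_bounded _ _ gone) in HC as [n Hn]; auto.
apply infinite; destruct (finite_balls n) as [l Hl]; exists l; intros g.
apply Hl, (Hn g (lenG g)); now apply wl_len.
Qed.

(** A uniform bound on lengths would pass, through the lifts of the elements [g] with all lamps off,
    to a bound on lengths in the infinite group [G]. *)
Lemma wreath_no_control_0 :
  ~ AN_linear_control (wreath_dist G H SG) (wreath_elt G H) 0.
Proof.
assert (Hlift : forall g : G, wreath_elt G H (fun _ => gone, g)).
{ intros g; exists nil; intros c Hc; now contradict Hc. }
intros HC; apply (@AN_linear_control_0_bounded W _ _ gone) in HC as [n Hn].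
- apply infinite; destruct (finite_balls n) as [l Hl]; exists l; intros g.
  destruct (wreath_generated G H SG (fun _ => gone, g) generated finite_balls)
    as [m Hm]; auto.
  apply Hl; exact (wl_snd _ _ _ _ _ (Hn _ _ Hm)).
- apply Hlift.
(* Writing [y] as the inverse of its inverse turns the product with [a] into quotients, for which
   finite support is known. *)
- intros y a Hy Ha; rewrite <- (ginvK y), <- (gmul1_r (ginv y)).
  apply wreath_elt_div; [apply wreath_elt_div; [exact Hy|apply Hlift]|].
  destruct (finite_balls 1) as [l Hl]; exists l; intros c Hc.
  apply Hl, (lit_within_letter _ _ _ _ Ha c Hc).
Qed.

End WreathControl.

Theorem theorem5p1 (G H : Group) (SG : list G)
  (G_infinite : ~ exists l : list G, forall g : G, In g l)
  (SG_generates : forall g : G,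
      exists n, word_len_le gmul gone ginv (fun s => In s SG) g n)
  (H_finite : exists l : list H, forall h : H, In h l)
  (growth_linear : exists a b : R, forall r : R, r > 0 ->
      exists l : list G,
        (forall g : G,
           INR (word_length gmul gone ginv (fun s => In s SG) g) < r -> In g l)
        /\ INR (length l) <= a * r + b) :
  dimAN_eq (wreath_dist G H SG) (wreath_kernel G H) 0
  /\ dimAN_eq (wreath_dist G H SG) (wreath_elt G H) 1
  /\ dimAN_eq (group_dist G SG) (fun _ => True) 1.
Proof.
assert (growth : exists A, forall n, exists l : list G,
  (forall g, (word_length gmul gone ginv (fun s => In s SG) g <= n)%nat -> In g l) /\
  (length l <= A * (n + 1))%nat).
{ destruct growth_linear as [a [b Hab]].
  (* The strict ball of radius [n + 1] contains all lengths up to [n], and both [a] and [b] are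
     absorbed into one factor of [n + 1]. *)
  destruct (INR_unbounded (Rabs a + Rabs b)) as [A HA]; exists A; intros n.
  pose proof (pos_INR n); destruct (Hab (INR n + 1)) as [l [Hl Ll]]; [lra|].
  exists l; split.
  - intros g Hg; apply Hl; apply le_INR in Hg; lra.
  - apply INR_le; rewrite mult_INR, plus_INR; simpl (INR 1).
    pose proof (Rle_abs a); pose proof (Rle_abs b); pose proof (Rabs_pos b); nra. }
destruct growth as [A growth]; repeat split.
- exact (wreath_kernel_control G H SG SG_generates A growth).
- lia.
- exact (wreath_control G H SG SG_generates A growth).
- intros m Hm; replace m with 0%nat by lia.
  exact (wreath_no_control_0 G H SG SG_generates A growth G_infinite).
- exact (group_control G SG SG_generates A growth).
- intros m Hm; replace m with 0%nat by lia.
  exact (group_no_control_0 G SG SG_generates A growth G_infinite).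
Qed.
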